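(* Let $X$ be a semitopological semilattice. Then the following conditions are equivalent: (1) $X$ is a $U$-semilattice; (2) $X$ is a $W$-semilattice; (3) for any open set $U\subset X$ with $U={\uparrow}U$ and any point $x\in U$ there exists a point $y\in U$ whose upper set ${\uparrow}y$ is a neighborhood of $x$ in $X$.
   Context: A semilattice is a commutative semigroup of idempotents, ordered by $x\le y$ iff $xy=x$; ${\uparrow}x=\{y\in X:x\le y\}$ and ${\uparrow}F=\bigcup_{y\in F}{\uparrow}y$ for $F\subset X$. A semitopological semilattice is a semilattice with a topology for which the operation $(x,y)\mapsto xy$ is separately continuous (no separation axiom is assumed). $X$ is a $U$-semilattice if for each open set $V\subset X$ and each $x\in V$ there is $v\in V$ such that ${\uparrow}v$ contains $x$ in its interior in $X$. $X$ is a $W$-semilattice if for each open set $V\subset X$ and each $x\in V$ there is a finite subset $F\subset V$ such that ${\uparrow}F$ contains $x$ in its interior in $X$. A neighborhood of $x$ is a set containing $x$ in its interior. *)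

(* Defs.v *)
From HB Require Import structures.
From mathcomp Require Import all_boot all_order.
From mathcomp Require Import boolp classical_sets cardinality.
From mathcomp Require Import filter topology_structure.

Set Implicit Arguments.
Unset Strict Implicit.
Unset Printing Implicit Defensive.

Import Order.TTheory.

Local Open Scope classical_set_scope.

(* The semilattice operation is Order.meet, written x `&` y in order_scope: it
   is commutative, associative and idempotent, and the order is the one it
   induces, (x <= y) = (x `&` y == x) by leEmeet. *)
HB.mixin Record isSemitopologicalSemilattice (d : Order.disp_t) (T : Type)
    & Topological T & Order.MeetSemilattice d T := {
  meet_continuousl : forall y : T, continuous (fun x : T => (x `&` y)%O) ;
  meet_continuousr : forall x : T, continuous (fun y : T => (x `&` y)%O) ;
}.

(* HB rejects this join once OrderNbhs is loaded, so topology_structure is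
   imported here instead of topology. *)
#[short(type="semitopologicalSemilatticeType")]
HB.structure Definition SemitopologicalSemilattice (d : Order.disp_t) :=
  { T of Topological T & Order.MeetSemilattice d T
       & isSemitopologicalSemilattice d T }.

Section upper_sets.
Context {d : Order.disp_t} {X : semitopologicalSemilatticeType d}.

Definition up (x : X) : set X := [set y | (x <= y)%O].

Definition up_set (F : set X) : set X := \bigcup_(y in F) up y.

End upper_sets.

Definition U_semilattice (d : Order.disp_t)
    (X : semitopologicalSemilatticeType d) : Prop :=
  forall V : set X, open V -> forall x : X, V x ->
    exists2 v : X, V v & (up v)° x.

Definition W_semilattice (d : Order.disp_t)
    (X : semitopologicalSemilatticeType d) : Prop :=
  forall V : set X, open V -> forall x : X, V x ->
    exists F : set X, [/\ finite_set F, F `<=` V & (up_set F)° x].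

(* Main.v *)
Require Import Defs.
From HB Require Import structures.
From mathcomp Require Import all_boot all_order.
From mathcomp Require Import boolp classical_sets cardinality.
From mathcomp Require Import filter topology_structure.

(** Two facts carry the equivalence.

    Upper sets of open sets are open ([open_up_set]).  Hence the condition on
    open upper sets, applied to the upper set of an arbitrary open [V], gives
    [y] above some [v] in [V]; since [up y] is contained in [up v], this [v]
    witnesses the [U]-property.

    If the upper set of a finite [F] is a neighborhood of [x], then already the
    upper set of a single [f] in [F] is one ([interior_up_set_finite]), so the
    [W]-property gives the condition on open upper sets.  Otherwise every
    neighborhood of [x] contains, for each [f] in [F], a point that is not above
    [f].  Multiplying [x] successively by such points [z1], ..., [zn], one for
    each element of [F], gives a point above no element of [F].  Separate
    continuity suffices to keep this product in a given open neighborhood [O] of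
    [x]: if [w <= x] lies in [O], then so does the product of [w] and [z] for
    every [z] close enough to [x], because the product of [w] and [x] is [w].
    Taking for [O] the interior of the upper set of [F] yields a
    contradiction. *)

Import Order.TTheory.

Local Open Scope classical_set_scope.

Section upper_set_neighborhoods.
Context {d : Order.disp_t} {X : semitopologicalSemilatticeType d}.
Implicit Types (x y z w : X) (O V F : set X) (s : seq X).

Lemma nbhs_meet_mem O w x : open O -> O w -> (w <= x)%O ->
  nbhs x [set z | O (w `&` z)%O].
Proof.
move=> oO Ow /meet_l wx; apply: (@meet_continuousr d X w x).
by rewrite wx; apply: open_nbhs_nbhs.
Qed.

(** If [v] in [V] lies below [y], multiplication by [v] sends [y] to [v], hence
    sends a neighborhood of [y] into [V]; and every [z] is above its product
    with [v]. *)
Lemma open_up_set V : open V -> open (up_set V).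
Proof.
move=> oV; rewrite openE => y [v Vv vy].
apply: filterS (nbhs_meet_mem _ _ _ oV Vv vy) => z /= Vvz.
by exists (v `&` z)%O => //; exact: leIr.
Qed.

(** The induction multiplies by one new point for each element of [s]; the
    conclusion [w <= x] is what allows the next step. *)
Lemma meet_avoid_up O x s : open O -> O x ->
  (forall f, f \in s -> ~ nbhs x (up f)) ->
  exists w, [/\ O w, (w <= x)%O & forall f, f \in s -> ~ (f <= w)%O].
Proof.
move=> oO Ox; elim: s => [_|f s IHs avoid]; first by exists x; split.
have [|w [Ow wx ws]] := IHs.
  by move=> g gs; apply: avoid; rewrite inE gs orbT.
have [z Owz fz] : exists2 z, O (w `&` z)%O & ~ (f <= z)%O.
  apply: contrapT => noz; apply: (avoid f (mem_head f s)).
  apply: filterS (nbhs_meet_mem _ _ _ oO Ow wx) => z /= Owz.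
  by apply: contrapT => fz; apply: noz; exists z.
exists (w `&` z)%O; split=> //; first exact: leIxl.
move=> g; rewrite inE lexI => /predU1P[->|gs] /andP[gw gz]; first exact: fz.
exact: ws gs gw.
Qed.

(** If no single [up f] were a neighborhood of [x], [meet_avoid_up] would give a
    point of the interior of [up_set F] above no element of [F], which is
    absurd. *)
Lemma interior_up_set_finite F x : finite_set F -> (up_set F)° x ->
  exists2 f, F f & nbhs x (up f).
Proof.
move=> /finite_seqP[s ->] Fx; apply: contrapT => nof.
have [|w [Fw _ ws]] := meet_avoid_up _ x s (open_interior (up_set [set` s])) Fx.
  by move=> f fs fx; apply: nof; exists f.
by have [f fs fw] := interior_subset Fw; exact: ws fs fw.
Qed.

End upper_set_neighborhoods.

Theorem theorem6p1 (d : Order.disp_t) (X : semitopologicalSemilatticeType d) :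
  [<-> U_semilattice X;
       W_semilattice X;
       forall U : set X, open U -> U = up_set U ->
         forall x : X, U x -> exists2 y : X, U y & nbhs x (up y)].
Proof.
tfae.
- move=> UX V oV x Vx; have [v Vv vx] := UX V oV x Vx.
  exists [set v]; split; [exact: finite_set1 | by move=> _ -> |].
  by rewrite /up_set bigcup_set1.
- move=> WX U oU _ x Ux; have [F [finF FU Fx]] := WX U oU x Ux.
  have [f Ff fx] := interior_up_set_finite _ _ finF Fx.
  by exists f => //; exact: FU.
- move=> upX V oV x Vx.
  have up_idem : up_set V = up_set (up_set V).
    apply/seteqP; split=> [y Vy|y [z [v Vv vz] zy]].
      by exists y => //; exact: lexx.
    by exists v => //; exact: le_trans vz zy.
  have Vx' : up_set V x by exists x => //; exact: lexx.
  have [y [v Vv vy] yx] := upX _ (open_up_set V oV) up_idem x Vx'.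
  by exists v => //; apply: filterS yx => z; exact: le_trans vy.
Qed.
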